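(* For every non-trivial finite abelian group $A$, there exists a bireversible Mealy automaton $\mathcal{M}$ such that the group $G_{\mathcal{M}}$ generated by $\mathcal{M}$ is isomorphic to the lamplighter group $A\wr \mathbb{Z}$.
   Context: A Mealy automaton is a tuple $\mathcal{M}=(Q,L,\lambda,\rho)$ where $Q$ (set of states) and $L$ (alphabet) are finite sets, and $\lambda\colon Q\times L\to L$ (output map) and $\rho\colon Q\times L\to Q$ (transition map) are maps. $\mathcal{M}$ is invertible if for all $q\in Q$ the map $\lambda(q,\cdot)\colon L\to L$ is a bijection; it is reversible if for all $l\in L$ the map $\rho(\cdot,l)\colon Q\to Q$ is a bijection; it is bireversible if it is invertible, reversible, and the map $\delta\colon Q\times L\to L\times Q$, $(q,l)\mapsto(\lambda(q,l),\rho(q,l))$ is a bijection. Let $L[[t]]$ be the set of formal power series $s_0+s_1t+s_2t^2+\dots$ with $s_i\in L$ (i.e. infinite sequences over $L$), and for $f(t)=s_0+s_1t+s_2t^2+\dots$ let $f^{\sigma}(t)=s_1+s_2t+s_3t^2+\dots$, so that $f(t)=s_0+f^\sigma(t)t$. Each $q\in Q$ recursively defines a map $\tau_q\colon L[[t]]\to L[[t]]$ by $\tau_q(f(t))=\lambda(q,s_0)+\tau_{\rho(q,s_0)}(f^{\sigma}(t))\,t$. If $\mathcal{M}$ is invertible, each $\tau_q$ is a bijection, and the group generated by $\mathcal{M}$ is the subgroup $G_{\mathcal{M}}\leq \mathrm{Sym}(L[[t]])$ generated by $\{\tau_q\mid q\in Q\}$. The lamplighter group is the restricted wreath product $A\wr\mathbb{Z}=\left(\bigoplus_{\mathbb{Z}}A\right)\rtimes\mathbb{Z}$,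 where $\mathbb{Z}$ acts by shifting the coordinates. *)

(* Defs.v *)
From HB Require Import structures.
From mathcomp Require Import all_boot all_order all_algebra.
From mathcomp Require Import all_classical.

Set Implicit Arguments.
Unset Strict Implicit.
Unset Printing Implicit Defensive.

Import GRing.Theory.

Local Open Scope classical_set_scope.
Local Open Scope ring_scope.

Section Sym.
Variable X : Type.

Record Sym := MkSym { sym_fun :> X -> X; sym_bij : bijective sym_fun }.

HB.instance Definition _ := gen_eqMixin Sym.
HB.instance Definition _ := gen_choiceMixin Sym.

Lemma sym_ext (s t : Sym) : s =1 t -> s = t.
Proof.
case: s t => [f bf] [g bg] /= /funext fg; subst g; congr MkSym.
exact: Prop_irrelevance.
Qed.

Definition sym_invfun_spec (s : Sym) :
  {g : X -> X | cancel s g /\ cancel g s}.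
Proof. by apply: cid; case: (sym_bij s) => g sK gK; exists g. Qed.

Definition sym_invfun (s : Sym) : X -> X := projT1 (sym_invfun_spec s).

Lemma sym_invfunK (s : Sym) : cancel s (sym_invfun s).
Proof. exact: (projT2 (sym_invfun_spec s)).1. Qed.

Lemma sym_funK (s : Sym) : cancel (sym_invfun s) s.
Proof. exact: (projT2 (sym_invfun_spec s)).2. Qed.

Definition sym_one : Sym :=
  @MkSym id (Bijective (g := id) (frefl id) (frefl id)).
Definition sym_mul (s t : Sym) : Sym :=
  MkSym (bij_comp (sym_bij s) (sym_bij t)).
Definition sym_inv (s : Sym) : Sym :=
  MkSym (Bijective (sym_funK s) (sym_invfunK s)).

Fact sym_mulA : associative sym_mul.
Proof. by move=> s t u; apply: sym_ext. Qed.
Fact sym_1mul : left_id sym_one sym_mul.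
Proof. by move=> s; apply: sym_ext. Qed.
Fact sym_mul1 : right_id sym_one sym_mul.
Proof. by move=> s; apply: sym_ext. Qed.
Fact sym_Vmul : left_inverse sym_one sym_inv sym_mul.
Proof. by move=> s; apply: sym_ext => x; exact: sym_invfunK. Qed.
Fact sym_mulV : right_inverse sym_one sym_inv sym_mul.
Proof. by move=> s; apply: sym_ext => x; exact: sym_funK. Qed.

HB.instance Definition _ :=
  isGroup.Build Sym sym_mulA sym_1mul sym_mul1 sym_Vmul sym_mulV.
End Sym.

Section GeneratedSubgroup.
Variables (G : groupType) (S : set G).

Definition generated : set G := smallest (fun H : set G => group_closed [in H]) S.

Fact generated_group_closed : group_closed [in generated].
Proof.
split=> [|x y]; rewrite !inE.
  by move=> H /= [[H1 _] _]; exact: set_mem.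
move=> gx gy H /= HS; apply: set_mem.
by apply: HS.1.2; apply: mem_set; [exact: gx|exact: gy].
Qed.

Record generated_group :=
  MkGenerated { generated_val :> G; _ : generated_val \in generated }.

HB.instance Definition _ := [isSub for generated_val].
HB.instance Definition _ := [Choice of generated_group by <:].
HB.instance Definition _ :=
  SubChoice_isSubGroup.Build G (fun x => x \in generated) generated_group
    generated_group_closed.
End GeneratedSubgroup.

Definition isomorphic (G H : groupType) : Prop :=
  exists f : {multiplicative G -> H}, bijective f.

Record mealy := Mealy {
  state : finType;
  letter : finType;
  output : state -> letter -> letter;
  transition : state -> letter -> state
}.

Section MealyAutomaton.
Variable M : mealy.
Local Notation Q := (state M).
Local Notation L := (letter M).

Definition invertible : Prop := forall q : Q, bijective (@output M q).

Definition reversible : Prop :=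
  forall l : L, bijective (fun q : Q => transition q l).

Definition bireversible : Prop :=
  [/\ invertible, reversible &
    bijective (fun ql : Q * L =>
      (output ql.1 ql.2, transition ql.1 ql.2))].

(* [series] is L[[t]]: the formal power series s_0 + s_1 t + ... over the bare
   set L, encoded by its coefficients n |-> s_n. *)
Definition series := nat -> L.

Definition shift (f : series) : series := fun n => f n.+1.

Fixpoint tau (q : Q) (f : series) (n : nat) : L :=
  if n is n'.+1 then tau (transition q (f 0%N)) (shift f) n'
  else output q (f 0%N).
End MealyAutomaton.

Lemma tau_rec (M : mealy) (q : state M) (f : series M) :
  tau q f 0%N = output q (f 0%N) /\
  shift (tau q f) = tau (transition q (f 0%N)) (shift f).
Proof. by []. Qed.

Section AutomatonGroup.
Variables (M : mealy) (invM : invertible M).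
Local Notation Q := (state M).
Local Notation L := (letter M).

Let inv_output (q : Q) : L -> L := invF (bij_inj (invM q)).

Let inverse_automaton : mealy :=
  @Mealy Q L inv_output (fun q l => transition q (inv_output q l)).

Lemma tau_bij (q : Q) : bijective (tau q).
Proof.
exists (@tau inverse_automaton q) => f; apply/funext => n.
  elim: n q f => [|n IHn] q f /=; first exact: invF_f.
  by rewrite /inv_output invF_f; exact: IHn.
elim: n q f => [|n IHn] q f /=; first exact: f_invF.
exact: IHn.
Qed.

Definition tau_sym (q : Q) : Sym (series M) := MkSym (tau_bij q).

Definition automaton_group : groupType := generated_group (range tau_sym).
End AutomatonGroup.

Lemma bireversible_invertible (M : mealy) : bireversible M -> invertible M.
Proof. by case. Qed.

Section Lamplighter.
Variable A : zmodType.

Definition finitely_supported : set (int -> A) :=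
  [set f | finite_set [set n | f n != 0]].

Fact finitely_supported_zmod_closed : zmod_closed [in finitely_supported].
Proof.
split=> [|f g]; rewrite !inE /finitely_supported /=.
  by rewrite (_ : [set _ | _] = set0) //; apply/seteqP; split=> n //=;
    rewrite eqxx.
move=> finf fing; apply: sub_finite_set (_ : finite_set
  ([set n | f n != 0] `|` [set n | g n != 0])); last by rewrite finite_setU.
move=> n /=; case: (eqVneq (f n) 0) => [fn0|]; last by left.
case: (eqVneq (g n) 0) => [gn0|]; last by right.
by rewrite /GRing.add /GRing.opp /= fn0 gn0 subrr eqxx.
Qed.

Record dsum :=
  MkDsum { dsum_val :> int -> A; _ : dsum_val \in finitely_supported }.

HB.instance Definition _ := [isSub for dsum_val].
HB.instance Definition _ := [Choice of dsum by <:].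
HB.instance Definition _ :=
  GRing.SubChoice_isSubZmodule.Build (int -> A)
    (fun f => f \in finitely_supported) dsum finitely_supported_zmod_closed.

Fact dsum_shift_subproof (m : int) (f : dsum) :
  (fun n => f (n - m)) \in finitely_supported.
Proof.
case: f => f /=; rewrite !inE /finitely_supported /= => finf.
apply: (@sub_finite_set _ _ ((fun n => n + m) @` [set n | f n != 0])).
  by move=> n /= fn; exists (n - m); rewrite ?subrK.
exact: finite_image.
Qed.

Definition dsum_shift (m : int) (f : dsum) : dsum :=
  MkDsum (dsum_shift_subproof m f).

(* A wr Z; the pair (f, m) stands for the product of f in the base group and of
   the m-th power of the generator of Z. *)
Record lamplighter := Lamp { lamps : dsum; position : int }.

Definition lamp_pair (x : lamplighter) := (lamps x, position x).
Definition pair_lamp (x : dsum * int) := Lamp x.1 x.2.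
Fact lamp_pairK : cancel lamp_pair pair_lamp. Proof. by case. Qed.
HB.instance Definition _ := Choice.copy lamplighter (can_type lamp_pairK).

Definition lamp_one := Lamp 0 0.
Definition lamp_mul (x y : lamplighter) :=
  Lamp (lamps x + dsum_shift (position x) (lamps y)) (position x + position y).
Definition lamp_inv (x : lamplighter) :=
  Lamp (- dsum_shift (- position x) (lamps x)) (- position x).

Fact lamp_ext (x y : lamplighter) :
  lamps x =1 lamps y -> position x = position y -> x = y.
Proof.
case: x y => [f m] [g n] /= fg ->; congr Lamp.
by apply: val_inj; apply/funext.
Qed.

Fact lamp_mulA : associative lamp_mul.
Proof.
move=> x y z; apply: lamp_ext => [n|] /=; last by rewrite addrA.
by rewrite -[LHS]/(_ + (_ + _)) -[RHS]/(_ + _ + _) addrA opprD addrA.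
Qed.
Fact lamp_1mul : left_id lamp_one lamp_mul.
Proof.
move=> x; apply: lamp_ext => [n|] /=; last by rewrite add0r.
by rewrite -[LHS]/(0 + _) add0r subr0.
Qed.
Fact lamp_mul1 : right_id lamp_one lamp_mul.
Proof.
move=> x; apply: lamp_ext => [n|] /=; last by rewrite addr0.
by rewrite -[LHS]/(_ + 0) addr0.
Qed.
Fact lamp_Vmul : left_inverse lamp_one lamp_inv lamp_mul.
Proof.
move=> x; apply: lamp_ext => [n|] /=; last by rewrite addNr.
by rewrite -[LHS]/(- _ + _) addNr.
Qed.
Fact lamp_mulV : right_inverse lamp_one lamp_inv lamp_mul.
Proof.
move=> x; apply: lamp_ext => [n|] /=; last by rewrite addrN.
by rewrite -[LHS]/(_ - lamps x (n - _ - - _)) opprK subrK subrr.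
Qed.

HB.instance Definition _ :=
  isGroup.Build lamplighter
    lamp_mulA lamp_1mul lamp_mul1 lamp_Vmul lamp_mulV.
End Lamplighter.

(* Main.v *)
(* Take states A, letters A * A and q : (a, b) |-> (b, a + q), moving to the
   state q + b.  Writing an input as a pair (f, g) of power series over A, the
   state q acts as e(q) + u(f, g) with u(f, g) = (g, f + w g), w = t / (1 - t)
   and e(q) = (0, q / (1 - t)).  So the generated group consists of the affine
   maps x |-> sum_n u^n(e(a_n)) + u^m(x), and it is A wr Z as soon as the
   vectors u^n(e(a_n)) are independent.  The second coordinate of u^n(e(q)) is
   F(w) q / (1 - t) with F a (Fibonacci) polynomial, monic of degree n, and
   the coefficients of w^n / (1 - t) are the binomials 'C(k, n); so the n-th
   finite difference isolates the leading lamp. *)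
Require Import Defs.
From HB Require Import structures.
From mathcomp Require Import all_boot all_order all_algebra.
From mathcomp Require Import all_classical.
From mathcomp Require Import finmap zify.

Set Implicit Arguments.
Unset Strict Implicit.
Unset Printing Implicit Defensive.

Import GRing.Theory.

Local Open Scope classical_set_scope.
Local Open Scope ring_scope.

(** * Generated subgroups as images of injective morphisms *)

Lemma group_closed_range (G H : groupType) (phi : UMagmaMorphism.type H G) :
  group_closed [in range phi].
Proof.
split=> [|_ _ /set_mem[x _ <-] /set_mem[y _ <-]]; apply: mem_set.
  by exists 1%g => //; rewrite gmulf1.
by exists (x / y)%g => //; rewrite gmulfF.
Qed.

Lemma isomorphic_generated (G H : groupType) (S : set G)
    (phi : UMagmaMorphism.type H G) :
  injective phi -> range phi = generated S ->
  isomorphic (generated_group S) H.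
Proof.
move=> phi_inj phiS.
have phi_gen y : phi y \in generated S.
  by rewrite -phiS; apply: mem_set; exists y.
pose g y : generated_group S := MkGenerated (phi_gen y).
have phiV (x : generated_group S) : exists y, phi y = generated_val x.
  have /set_mem : generated_val x \in range phi by rewrite phiS; case: x.
  by case=> y _ <-; exists y.
pose f x := projT1 (cid (phiV x)).
have fE x : phi (f x) = generated_val x by rewrite /f; case: cid.
have fM : {morph f : x y / (x * y)%g}.
  by move=> x y; apply: phi_inj; rewrite gmulfM !fE.
pose F : {multiplicative generated_group S -> H} :=
  HB.pack f (isMultiplicative.Build _ _ f fM).
exists F; exists g => [x|y]; last by apply: phi_inj; rewrite fE.
by apply: val_inj; rewrite /= fE.
Qed.

(** * Integer powers in a group *)

Section IntegerPowers.
Variable G : groupType.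

Definition zexpg (x : G) (m : int) : G :=
  match m with Posz n => (x ^+ n)%g | Negz n => (x ^- n.+1)%g end.

Lemma zexpg1D x m : zexpg x (1 + m) = (x * zexpg x m)%g.
Proof.
case: m => n; first by rewrite /= -expgS.
case: n => [|n]; first by rewrite /= expg1 mulgV.
have -> : (1 + Negz n.+1 : int) = Negz n.
  by rewrite !NegzE -[n.+2]add1n PoszD opprD addNKr.
by rewrite /= [in RHS]expgSr invgM mulVKg.
Qed.

Lemma zexpgD x m n : zexpg x (m + n) = (zexpg x m * zexpg x n)%g.
Proof.
elim: m => [|m IHm|m IHm]; first by rewrite add0r mul1g.
  by rewrite -add1n PoszD -addrA !zexpg1D IHm mulgA.
(* Multiplying by [x] raises the exponent on both sides by one, back to the induction hypothesis. *)
apply: (mulgI x); rewrite -zexpg1D mulgA -zexpg1D.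
by rewrite -[m.+1]add1n PoszD opprD addrA !addNKr.
Qed.

End IntegerPowers.

(** * Finitely supported families and generators of the lamplighter group *)

Section LamplighterGroup.
Variable A : zmodType.

Lemma dsum_fsupport (a : dsum A) :
  exists X : {fset int}, forall n, n \notin X -> a n = 0.
Proof.
case: a => a aP; have a_fin := set_mem aP.
exists (fset_set [set n | a n != 0]) => n /=; rewrite in_fset_set //.
by rewrite notin_setE /= => /negP; rewrite negbK => /eqP.
Qed.

Fact dsum_single_subproof (n : int) (q : A) :
  (fun k => if k == n then q else 0) \in @finitely_supported A.
Proof.
apply: mem_set; apply: (@sub_finite_set _ _ [set n]) => //= k /=.
by case: (k =P n) => // _; rewrite eqxx.
Qed.

Definition dsum_single n q : dsum A := MkDsum (dsum_single_subproof n q).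

Lemma dsum_ext (a b : dsum A) : a =1 b -> a = b.
Proof. by move=> ab; apply: val_inj; apply/funext. Qed.

Lemma dsum_addE (a b : dsum A) n : (a + b) n = a n + b n.
Proof. by []. Qed.

Lemma dsum_sumE (I : Type) (r : seq I) (F : I -> dsum A) n :
  (\sum_(i <- r) F i) n = \sum_(i <- r) F i n.
Proof. exact: (big_morph (fun a : dsum A => a n)). Qed.

Lemma dsum_sum_single (a : dsum A) :
  exists X : {fset int}, a = \sum_(n <- X) dsum_single n (a n).
Proof.
have [X aX] := dsum_fsupport a; exists X; apply: dsum_ext => n.
rewrite dsum_sumE; have [nX|nX] := boolP (n \in X).
  rewrite (big_fsetD1 n) //= eqxx big_seq big1 ?addr0 // => k.
  by rewrite !inE => /andP[/negPf kn _]; rewrite eq_sym kn.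
rewrite aX // big_seq big1 // => k kX /=.
by case: eqVneq => // nk; rewrite nk kX in nX.
Qed.

(** These generators match the states of the automaton. The one with [q = 0] is the shift; its
    powers carry a lamp to any position, and finite sums of single lamps give the base group. *)
Lemma lamplighter_generators (H : {pred lamplighter A}) :
  group_closed H -> (forall q, Lamp (dsum_single 0 q) 1 \in H) ->
  forall x, x \in H.
Proof.
move=> Hgrp Hgen; have HM := group_closedM Hgrp.
have single0 n : dsum_single n 0 = 0.
  by apply: dsum_ext => k /=; case: ifP.
have H01 : Lamp 0 1 \in H by rewrite -(single0 0).
have HV x : x \in H -> (x^-1)%g \in H by exact: group_closedV.
have H0 m : Lamp 0 m \in H.
  have lampD m' : Lamp 0 (1 + m') = (Lamp 0 1 * Lamp 0 m')%g :> lamplighter A.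
    by apply: lamp_ext => [n|//]; rewrite /= addr0.
  elim: m => [|m IHm|m IHm]; first exact: Hgrp.1.
    by rewrite -add1n PoszD lampD; exact: HM.
  have -> : Lamp 0 (- (m.+1%:Z)) = ((Lamp 0 1)^-1 * Lamp 0 (- m%:Z))%g
      :> lamplighter A.
    apply: (mulgI (Lamp 0 1)); rewrite mulVKg -lampD.
    by rewrite -add1n PoszD opprD addNKr.
  by apply: HM => //; exact: HV.
have Hsingle n q : Lamp (dsum_single n q) 0 \in H.
  (* Walk to [n], light the lamp there while stepping to [n + 1], and walk back by [- 1 - n]. *)
  have -> : Lamp (dsum_single n q) 0 =
      (Lamp 0 n * (Lamp (dsum_single 0 q) 1 * Lamp 0 (- 1 - n)))%g
      :> lamplighter A.
    apply: lamp_ext => [k|] /=.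
      rewrite -[RHS]/(0 + ((if k - n == 0 then q else 0) + 0)).
      by rewrite addr0 add0r subr_eq0.
    by rewrite -[RHS]/(n + (1 + (- 1 - n))) addNKr subrr.
  by apply: (HM) => //; exact: HM.
have Hsum a : Lamp a 0 \in H.
  have [X ->] := dsum_sum_single a.
  elim/big_ind: _ => [|b c Hb Hc|n _]; [exact: H0| |exact: Hsingle].
  have -> : Lamp (b + c) 0 = (Lamp b 0 * Lamp c 0)%g :> lamplighter A.
    by apply: lamp_ext => [k|//]; rewrite -[RHS]/(b k + c (k - 0)) subr0.
  exact: HM.
case=> a m; have -> : Lamp a m = (Lamp a 0 * Lamp 0 m)%g :> lamplighter A.
  by apply: lamp_ext => [k|]; rewrite /= ?addr0 ?add0r.
exact: HM.
Qed.

End LamplighterGroup.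

(** * The lamplighter group acting by affine maps *)

Section AffineAction.
Variables (A X : zmodType) (u : Sym X) (e : {additive A -> X}).
Hypothesis uD : {morph u : x y / x + y}.

Lemma zexpg_additive m : {morph zexpg u m : x y / x + y}.
Proof.
have exp n : {morph (u ^+ n)%g : x y / x + y}.
  elim: n => [|n IHn] x y //; rewrite !expgS.
  by rewrite -[LHS]/(u ((u ^+ n)%g (x + y))) IHn uD.
case: m => n x y /=; first exact: exp.
set v := (u ^+ n.+1)%g; have vK : cancel v (v^-1)%g := sym_invfunK v.
have Kv : cancel (v^-1)%g v := sym_funK v.
by apply: (can_inj vK); rewrite exp !Kv.
Qed.

Lemma zexpg_add0 m : zexpg u m 0 = 0.
Proof. by apply: (addrI (zexpg u m 0)); rewrite -zexpg_additive !addr0. Qed.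

(** The translation vector of the base element [a]; only finitely many terms are non-zero, since [e]
    and the powers of [u] fix 0. *)
Definition lamp_sum (a : dsum A) : X :=
  \sum_(n \in [set: int]) zexpg u n (e (a n)).

Lemma lamp_sumE (a : dsum A) (r : seq int) :
  uniq r -> (forall n, n \notin r -> a n = 0) ->
  lamp_sum a = \sum_(n <- r) zexpg u n (e (a n)).
Proof.
move=> r_uniq ar; rewrite /lamp_sum (@fsbigE _ _ _ _ _ r) // => [|n _ /ar ->].
  by apply: eq_bigl => n; rewrite mem_set.
by rewrite raddf0 zexpg_add0.
Qed.

Lemma lamp_sumD : {morph lamp_sum : a b / a + b}.
Proof.
move=> a b; have [Y aY] := dsum_fsupport a; have [Z bZ] := dsum_fsupport b.
have aW n : n \notin (Y `|` Z)%fset -> a n = 0.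
  by rewrite inE negb_or => /andP[/aY].
have bW n : n \notin (Y `|` Z)%fset -> b n = 0.
  by rewrite inE negb_or => /andP[_ /bZ].
rewrite !(@lamp_sumE _ (Y `|` Z)%fset) ?fset_uniq //.
  rewrite -big_split; apply: eq_bigr => n _.
  by rewrite dsum_addE raddfD zexpg_additive.
by move=> n nW; rewrite dsum_addE aW // bW // addr0.
Qed.

Fact lamp_sum0 : lamp_sum 0 = 0.
Proof. by apply: (addrI (lamp_sum 0)); rewrite -lamp_sumD !addr0. Qed.

HB.instance Definition _ :=
  GRing.isNmodMorphism.Build (dsum A) X lamp_sum (lamp_sum0, lamp_sumD).

(** Reindexing by [n |-> m + n] pulls out a factor [u^m]. This equivariance is what makes
    [lamp_action] compatible with the semidirect product. *)
Lemma lamp_sum_shift m (a : dsum A) :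
  lamp_sum (dsum_shift m a) = zexpg u m (lamp_sum a).
Proof.
have [Y aY] := dsum_fsupport a; rewrite (lamp_sumE _ aY) ?fset_uniq //.
rewrite (big_morph _ (zexpg_additive m) (zexpg_add0 m)).
rewrite /lamp_sum (@reindex_fsbigT _ _ _ _ _ (fun n => m + n)) /=; last first.
  by exists (fun n => - m + n) => n; [exact: addKr|exact: addNKr].
rewrite (@fsbigTE _ _ _ _ Y) => [|n nY]; last first.
  by rewrite addrAC subrr add0r aY // raddf0 zexpg_add0.
by apply: eq_bigr => n _; rewrite addrAC subrr add0r zexpgD.
Qed.

Lemma lamp_sum_single n q : lamp_sum (dsum_single n q) = zexpg u n (e q).
Proof.
rewrite (@lamp_sumE _ [:: n]) ?big_seq1 /= ?eqxx // => k.
by rewrite inE /= => /negPf ->.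
Qed.

Lemma lamp_action_bij (x : lamplighter A) :
  bijective (fun v => lamp_sum (lamps x) + zexpg u (position x) v).
Proof.
case: x => a m /=; apply: (bij_comp (f := fun v => lamp_sum a + v)).
  by exists (fun v => - lamp_sum a + v) => v; [exact: addKr|exact: addNKr].
exact: sym_bij.
Qed.

Definition lamp_action (x : lamplighter A) : Sym X := MkSym (lamp_action_bij x).

Fact lamp_actionM : {morph lamp_action : x y / (x * y)%g}.
Proof.
move=> [a m] [b n]; apply: sym_ext => v.
rewrite -[LHS]/(lamp_sum (a + dsum_shift m b) + zexpg u (m + n) v).
rewrite -[RHS]/(lamp_sum a + zexpg u m (lamp_sum b + zexpg u n v)).
by rewrite lamp_sumD lamp_sum_shift zexpg_additive zexpgD addrA.
Qed.

Fact lamp_action1 : lamp_action 1%g = 1%g.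
Proof. by apply: (mulgI (lamp_action 1%g)); rewrite -lamp_actionM !mulg1. Qed.

HB.instance Definition _ :=
  isUMagmaMorphism.Build (lamplighter A) (Sym X) lamp_action
    (lamp_action1, lamp_actionM).

(** Independence is assumed for non-negative powers of [u] only, which suffices: applying a high
    enough power of [u] makes all exponents non-negative. *)
Lemma lamp_sum_inj :
  (forall N (c : nat -> A), \sum_(i < N) (u ^+ i)%g (e (c i)) = 0 ->
    forall i : 'I_N, c i = 0) ->
  injective lamp_sum.
Proof.
move=> indep; apply: raddf_inj => a Sa0; have [Y aY] := dsum_fsupport a.
pose K := (\max_(n : Y) `|fsval n|)%N.
have YK n : n \in Y -> (`|n| <= K)%N.
  move=> nY.
  exact: (leq_bigmax (F := fun n : Y => `|fsval n|%N) [` nY]%fset).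
(* The support of [a] lies in [[-K, K]]; translated by [K] it lies in [[0, 2K]], hence the [K.*2.+1]
   terms. *)
pose c (i : nat) := a (i%:Z - K%:Z).
have sum_c : \sum_(i < K.*2.+1) (u ^+ i)%g (e (c i)) = 0.
  transitivity (zexpg u K (lamp_sum a)); last by rewrite Sa0 zexpg_add0.
  rewrite -lamp_sum_shift (@lamp_sumE _ [seq Posz i | i <- iota 0 K.*2.+1]).
  - by rewrite big_map -[iota 0 _]/(index_iota 0 K.*2.+1) big_mkord.
  - by rewrite map_inj_uniq ?iota_uniq // => i j [].
  - move=> n nI; apply: aY; apply: contra nI => /YK nK.
    apply/mapP; exists `|n|%N; first rewrite mem_iota; lia.
apply: dsum_ext => n; rewrite -[RHS]/(0 : A).
have [nY|/aY //] := boolP (n \in Y).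
have nK := YK _ nY.
have iK : (`|(n + K%:Z)%R| < K.*2.+1)%N by lia.
rewrite -(indep _ c sum_c (Ordinal iK)) /c /=; congr (a _); lia.
Qed.

(** If [(a, m)] acts trivially, its value at 0 gives [a = 0], so [u^m] is the identity. Then [q] lit
    at [m] and [q] lit at 0 have the same vector, which forces [m = 0]. *)
Lemma lamp_action_inj (q : A) :
  q != 0 -> injective lamp_sum -> injective lamp_action.
Proof.
move=> q0 S_inj; apply: gmulf_inj => -[a m] act1.
have {}act1 v : lamp_sum a + zexpg u m v = v.
  exact: (congr1 (fun s : Sym X => s v) act1).
have a0 : a = 0.
  by apply: S_inj; rewrite raddf0 -[RHS](act1 0) zexpg_add0 addr0.
have /S_inj/(congr1 (fun b : dsum A => b m)) :
    lamp_sum (dsum_single m q) = lamp_sum (dsum_single 0 q).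
  by rewrite !lamp_sum_single -[RHS]act1 a0 raddf0 add0r.
rewrite a0 /= eqxx; case: eqVneq => [-> //|_ q_eq0].
by rewrite q_eq0 eqxx in q0.
Qed.

Lemma lamp_action_range : range lamp_action =
  generated (range (fun q => lamp_action (Lamp (dsum_single 0 q) 1))).
Proof.
apply/seteqP; split=> [_ [x _ <-]|].
  move=> H /= [Hgrp Hgen]; apply: set_mem.
  (* The preimage of the subgroup [H] is a subgroup containing the generators. *)
  have := @lamplighter_generators A (fun x => lamp_action x \in H).
  apply=> [|q]; last by apply: mem_set; apply: Hgen; exists q.
  split=> [|y z]; rewrite !unfold_in /= ?gmulf1; first exact: Hgrp.1.
  by rewrite gmulfF; exact: Hgrp.2.
apply: smallest_sub; first exact: group_closed_range.
by move=> _ [q _ <-]; exists (Lamp (dsum_single 0 q) 1).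
Qed.

Lemma lamp_action_generator q v :
  lamp_action (Lamp (dsum_single 0 q) 1) v = e q + u v.
Proof. by rewrite -[e q]/(zexpg u 0 (e q)) -lamp_sum_single. Qed.

Definition lamp_morphism : UMagmaMorphism.type (lamplighter A) (Sym X) :=
  lamp_action.

End AffineAction.

(** * Iterated finite differences of sequences *)

Section DifferenceOperator.
Variable A : zmodType.

Definition diff (h : nat -> A) : nat -> A := fun n => h n.+1 - h n.

Lemma iter_diff0 k : iter k diff 0 = 0.
Proof.
by elim: k => //= k ->; apply/funext => n; rewrite /diff subrr.
Qed.

Lemma iter_diffD k : {morph iter k diff : f g / f + g}.
Proof.
move=> f g; elim: k => //= k ->; apply/funext => n.
by rewrite /diff -[RHS]/(_ - _ + (_ - _)) addrACA -opprD.
Qed.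

Lemma iter_diff_const k (q : A) : iter k.+1 diff (fun=> q) = 0.
Proof.
rewrite iterSr -[RHS](iter_diff0 k); congr iter.
by apply/funext => n; exact: subrr.
Qed.

End DifferenceOperator.

(** * The automaton and the independence of its translation vectors *)

Section FibonacciAutomaton.
Variable A : finZmodType.

Definition fib_mealy : mealy :=
  @Mealy A (A * A)%type (fun q l => (l.2, l.1 + q)) (fun q l => q + l.2).

Lemma fib_bireversible : bireversible fib_mealy.
Proof.
split=> [q|l|].
- exists (fun l : A * A => (l.2 - q, l.1)) => -[a b] /=.
    by rewrite addrK.
  by rewrite subrK.
- by exists (fun q : A => q - l.2) => q; rewrite /= ?addrK ?subrK.
(* From output [(b, c)] and new state [p = q + b], first recover [q = p - b], then [a = c - q]. *)
- exists (fun x : A * A * A =>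
      let: (b, c, p) := x in (p - b, (c - (p - b), b))).
    by move=> [q [a b]] /=; rewrite !addrK.
  by move=> [[b c] p] /=; rewrite !subrK.
Qed.

(** Output and transition are both additive in the pair (state, letter). Hence every [tau q] is the
    additive map [tau 0] followed by a translation. *)
Lemma fib_tauD (p q : A) (f g : nat -> A * A) :
  tau (p + q : state fib_mealy) (f + g : series fib_mealy) =
  (tau (p : state fib_mealy) (f : series fib_mealy) : nat -> A * A) +
  tau (q : state fib_mealy) (g : series fib_mealy).
Proof.
apply/funext => n; rewrite -[RHS]/(_ + _).
elim: n p q f g => [|n IHn] p q f g /=.
  by congr pair; rewrite addrACA.
by rewrite -IHn; congr (@tau fib_mealy _ _ n) => /=; rewrite addrACA.
Qed.

Lemma fib_tau_fst (q : state fib_mealy) (f : series fib_mealy) n :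
  (tau q f n).1 = (f n).2.
Proof. by elim: n q f => //= n IHn q f; rewrite IHn. Qed.

(** The bracket is the state reached after reading [n] letters. *)
Lemma fib_tau_snd (q : state fib_mealy) (f : series fib_mealy) n :
  (tau q f n).2 = (f n).1 + (q + \sum_(i < n) (f i).2).
Proof.
elim: n q f => [|n IHn] q f /=; first by rewrite big_ord0 addr0.
by rewrite IHn big_ord_recl [q + (_ + _)]addrA.
Qed.

Let fib_inv : invertible fib_mealy := bireversible_invertible fib_bireversible.

(** The type [series fib_mealy] again, presented with its pointwise group structure. *)
Definition fib_space : zmodType := (nat -> A * A)%type.

Definition fib_mul : Sym fib_space := tau_sym fib_inv 0.

Definition fib_translation (q : A) : fib_space := tau (q : state fib_mealy) 0.

Lemma fib_mulD : {morph fib_mul : f g / f + g}.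
Proof. by move=> f g; rewrite -[RHS]fib_tauD addr0. Qed.

Fact fib_translationD : {morph fib_translation : p q / p + q}.
Proof. by move=> p q; rewrite /fib_translation -fib_tauD addr0. Qed.

Fact fib_translation0 : fib_translation 0 = 0.
Proof.
by apply: (addrI (fib_translation 0)); rewrite -fib_translationD !addr0.
Qed.

HB.instance Definition _ := GRing.isNmodMorphism.Build A fib_space
  fib_translation (fib_translation0, fib_translationD).

Lemma fib_tauE (q : A) (f : fib_space) :
  tau (q : state fib_mealy) f = fib_translation q + fib_mul f :> fib_space.
Proof. by rewrite /fib_translation -fib_tauD addr0 add0r. Qed.

Definition fst_coord (f : fib_space) n := (f n).1.
Definition snd_coord (f : fib_space) n := (f n).2.

Lemma fst_fib_mul f : fst_coord (fib_mul f) = snd_coord f.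
Proof. by apply/funext => n; exact: fib_tau_fst. Qed.

(** Multiplication by [w = t / (1 - t)] takes partial sums, and [diff] undoes it. *)
Lemma diff_snd_fib_mul f :
  diff (snd_coord (fib_mul f)) = diff (fst_coord f) + snd_coord f.
Proof.
apply/funext => n.
have snd_mul k : snd_coord (fib_mul f) k = (f k).1 + \sum_(i < k) (f i).2.
  by rewrite /snd_coord fib_tau_snd add0r.
rewrite /diff !snd_mul big_ord_recr /= opprD addrACA.
by rewrite [_ + _ - \sum_(i < n) _]addrAC subrr add0r.
Qed.

(** The second coordinate grows like ['C(n, i)] times [q] plus lower terms, and the first has lower
    degree. Both are tracked at once because [fib_mul] moves the second coordinate into the
    first. *)
Lemma iter_diff_fib_pow i (q : A) :
  iter i (@diff A) (fst_coord ((fib_mul ^+ i)%g (fib_translation q))) = 0 /\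
  iter i (@diff A) (snd_coord ((fib_mul ^+ i)%g (fib_translation q))) =
    (fun=> q).
Proof.
elim: i => [|i [IHfst IHsnd]].
  split; apply/funext => n; rewrite /= /fst_coord /snd_coord.
    by rewrite fib_tau_fst.
  by rewrite fib_tau_snd /= big1 // addr0 add0r.
rewrite expgS; set f := sym_fun _ _ in IHfst IHsnd.
have -> : (fib_mul * fib_mul ^+ i)%g (fib_translation q) = fib_mul f by [].
(* In the second component the extra difference is applied first, so that [diff_snd_fib_mul] can be
   used; in the first it is applied last, to a constant sequence. *)
rewrite fst_fib_mul [in X in _ /\ X]iterSr.
rewrite diff_snd_fib_mul iter_diffD IHsnd -iterSr /= IHfst IHsnd.
split; apply/funext => n; first by rewrite /diff subrr.
by rewrite -[LHS]/(_ - _ + q) subrr add0r.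
Qed.

Lemma iter_diff_fib_pow_gt i k (q : A) : (i < k)%N ->
  iter k (@diff A) (snd_coord ((fib_mul ^+ i)%g (fib_translation q))) = 0.
Proof.
move=> /subnK <-; rewrite -addSnnS iterD (iter_diff_fib_pow i q).2.
exact: iter_diff_const.
Qed.

(** The [N]-th difference of the second coordinate kills the terms below the top one, which becomes
    the constant [c N]; so [c N = 0], and induction removes the remaining terms. *)
Lemma fib_pow_indep N (c : nat -> A) :
  \sum_(i < N) (fib_mul ^+ i)%g (fib_translation (c i)) = 0 ->
  forall i : 'I_N, c i = 0.
Proof.
elim: N => [_ [] //|N IHN] sum0.
pose D f := iter N (@diff A) (snd_coord f).
have D_add : {morph D : f g / f + g} by move=> f g; rewrite -iter_diffD.
have D0 : D 0 = 0 by exact: iter_diff0.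
have cN0 : c N = 0.
  have := congr1 D sum0.
  rewrite D0 big_ord_recr D_add /= (big_morph D D_add D0).
  rewrite big1 => [|i _]; last exact: iter_diff_fib_pow_gt.
  by rewrite add0r /D (iter_diff_fib_pow N _).2 => /(congr1 (fun f => f 0%N)).
move: sum0; rewrite big_ord_recr /= cN0 raddf0 => sum0 i.
have [->//|iN] := eqVneq (i : nat) N.
have iN' : (i < N)%N by rewrite ltn_neqAle iN -ltnS ltn_ord.
apply: (IHN _ (Ordinal iN')); rewrite -[RHS]sum0.
by rewrite (zexpg_add0 fib_mulD N) addr0.
Qed.

End FibonacciAutomaton.

(** * The automaton group as the image of the lamplighter group *)

Theorem theorem1p1 (A : finZmodType) :
  (1 < #|A|)%N ->
  exists (M : mealy) (birM : bireversible M),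
    isomorphic (automaton_group (bireversible_invertible birM)) (lamplighter A).
Proof.
move=> A_gt1; exists (fib_mealy A), (fib_bireversible A).
have [q q0] : exists q : A, q != 0.
  have /card_gt1P[p [q [_ _ pq]]] := A_gt1.
  by have [p0|p0] := eqVneq p 0; [exists q; rewrite -p0 eq_sym|exists p].
apply: (isomorphic_generated
  (phi := lamp_morphism (@fib_translation A) (@fib_mulD A))).
  exact: (lamp_action_inj (@fib_mulD A) q0
            (lamp_sum_inj (@fib_mulD A) (@fib_pow_indep A))).
(* Both groups are generated by the same permutations: [tau q] is the action of the lamp [q] at 0
   followed by one shift. *)
rewrite (lamp_action_range _ (@fib_mulD A)).
apply: congr1; apply: eq_imagel => p _.
apply: sym_ext => f; rewrite (lamp_action_generator _ (@fib_mulD A)).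
by symmetry; exact: fib_tauE.
Qed.
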